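(* Let $L=\{L(s),\,s\ge0\}$ be a Lévy process, $Y=\{Y(u),\,u\in\mathbb{R}\}$ a stationary process independent of $L$, and let $X=\{X(t),\,t>0\}$ be a process such that for every $a\ge0$ $$\{X(t)\}_{t\in(0,e^a]}\overset{d}{=}\left\{e^{L(a-\log t)-L(a)}\,Y(\log t)\right\}_{t\in(0,e^a]}.$$ If $X$ has finite variance, then $X$ cannot have stationary increments unless it is self-similar.
   Context: All processes are real-valued; $\{\cdot\}\overset{d}{=}\{\cdot\}$ denotes equality of finite dimensional distributions. Every process is assumed not identically null (some $X(t)$, $t\ne0$, has $P(X(t)\neq0)>0$). A Lévy process is a process starting at zero, with stationary independent increments, and stochastically continuous. Stationary means strictly stationary. Finite variance means $\mathbb{E}X(t)^2<\infty$ for all $t>0$. Stationary increments is understood with the convention $X(0)=0$: the finite dimensional distributions of the increments are invariant under time shifts, and in particular $X(t)-X(s)\overset{d}{=}X(t-s)$ for $t>s>0$. $X$ is self-similar if for every $a>0$ there exists a deterministic $b>0$ such that $\{X(at)\}_{t>0}\overset{d}{=}\{bX(t)\}_{t>0}$. *)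

(* Defs.v *)
From mathcomp Require Import all_boot all_order all_algebra.
From mathcomp Require Import all_classical all_reals all_analysis.

Set Implicit Arguments.
Unset Strict Implicit.
Unset Printing Implicit Defensive.

Import Order.TTheory GRing.Theory Num.Theory.
Import numFieldNormedType.Exports.

Local Open Scope classical_set_scope.
Local Open Scope ring_scope.

(* A process with index set [D : set I] is a family [X : I -> T -> R] of which
   only the members with index in [D] matter; every predicate below that takes
   [D], or fixes an index set, ignores the values at other indices. *)

(* {X(t)}_{t in D} and {Z(t)}_{t in D}, possibly living on different probability
   spaces, have the same finite-dimensional distributions: the vectors
   (X(t_1), ..., X(t_n)) and (Z(t_1), ..., Z(t_n)) have the same law on the
   product sigma-algebra of R^n. *)
Definition eq_fdd d d' (T : measurableType d) (T' : measurableType d')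
    (R : realType) (P : probability T R) (Q : probability T' R)
    (I : Type) (D : set I) (X : I -> T -> R) (Z : I -> T' -> R) : Prop :=
  forall (n : nat) (t : n.-tuple I), (forall i, D (tnth t i)) ->
  forall B : set (n.-tuple R), measurable B ->
    P [set w | B (map_tuple (X ^~ w) t)] =
    Q [set w | B (map_tuple (Z ^~ w) t)].

Section processes.
Context d (T : measurableType d) (R : realType) (P : probability T R).

Definition not_identically_null (D : set R) (X : R -> T -> R) : Prop :=
  exists t, [/\ D t, t != 0 & (0 < P [set w | X t w != 0%R])%E].

Definition stationary (X : R -> T -> R) : Prop :=
  forall h : R, eq_fdd P P setT (fun u => X (u + h)) X.

(* For processes indexed by [0, +oo[. *)
Definition stationary_increments (X : R -> T -> R) : Prop :=
  forall h : R, 0 <= h ->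
    eq_fdd P P [set st : R * R | 0 <= st.1 /\ 0 <= st.2]
      (fun st w => X (st.2 + h) w - X (st.1 + h) w)
      (fun st w => X st.2 w - X st.1 w).

(* The convention X(0) = 0, for a process indexed by ]0, +oo[. *)
Definition null_at_0 (X : R -> T -> R) : R -> T -> R :=
  fun t w => if t == 0 then 0 else X t w.

(* Taking some of the [B i] to be [setT] gives the product rule for every
   subfamily. *)
Definition mutually_independent n (Z : 'I_n -> T -> R) : Prop :=
  forall B : 'I_n -> set R, (forall i, measurable (B i)) ->
    P [set w | forall i, B i (Z i w)] = (\prod_(i < n) P (Z i @^-1` B i))%E.

(* For processes indexed by [0, +oo[. *)
Definition independent_increments (X : R -> T -> R) : Prop :=
  forall (n : nat) (t : nat -> R), 0 <= t 0%N ->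
    {homo t : i j / (i <= j)%N >-> i <= j} ->
    mutually_independent (fun (i : 'I_n) w => X (t i.+1) w - X (t i) w).

(* For processes indexed by [0, +oo[. *)
Definition stochastically_continuous (X : R -> T -> R) : Prop :=
  forall s eps : R, 0 <= s -> 0 < eps ->
    P [set w | eps <= `|X t w - X s w|]
      @[t --> within [set t | 0 <= t] (nbhs s)] --> 0%E.

Definition levy_process (L : R -> T -> R) : Prop :=
  [/\ {ae P, forall w, L 0 w = 0},
      stationary_increments L,
      independent_increments L &
      stochastically_continuous L].

Definition sigma_process (D : set R) (X : R -> T -> R) : set (set T) :=
  <<s \bigcup_(t in D) preimage_set_system setT (X t) measurable >>.

Definition independent_processes (D : set R) (X : R -> T -> R)
    (E : set R) (Z : R -> T -> R) : Prop :=
  forall A B, sigma_process D X A -> sigma_process E Z B ->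
    P (A `&` B) = (P A * P B)%E.

(* For processes indexed by ]0, +oo[. *)
Definition finite_variance (X : R -> T -> R) : Prop :=
  forall t : R, 0 < t -> ('E_P[fun w => (X t w ^+ 2)%R] < +oo)%E.

(* For processes indexed by ]0, +oo[. *)
Definition self_similar (X : R -> T -> R) : Prop :=
  forall a : R, 0 < a -> exists2 b : R, 0 < b &
    eq_fdd P P [set t | 0 < t] (fun t => X (a * t)) (fun t w => b * X t w).

End processes.

(* Main.v *)
Require Import Defs.
From HB Require Import structures.
From mathcomp Require Import all_boot all_order all_algebra.
From mathcomp Require Import all_classical all_reals all_analysis.
From mathcomp Require Import measurable_realfun ring.

Set Implicit Arguments.
Unset Strict Implicit.
Unset Printing Implicit Defensive.

Import Order.TTheory GRing.Theory Num.Theory.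
Import numFieldNormedType.Exports.

Local Open Scope classical_set_scope.
Local Open Scope ring_scope.

(** In the representation, [X(e^u)] is [Y(u)] times the exponential of a two-sided
    Levy process, so that dilating time by [l > 1] multiplies [X] by an independent
    factor: the pair [(X(l), X(l + 1))] is distributed as
    [e^(-L(ln l)) (X(1), X(1 + 1/l))]. If [X] also has stationary increments, then
    in second moments
    [E X(1)^2 = E (X(l + 1) - X(l))^2 = E e^(-2 L(ln l)) E (X(1 + 1/l) - X(1))^2
              = E e^(-2 L(ln l)) E X(1/l)^2
              = E e^(-2 L(ln l)) E e^(2 L(ln l)) E X(1)^2],
    the last step because [X(1/l)] is distributed as [e^(L(ln l)) Y(- ln l)]. As
    [E X(1)^2] is finite and positive, [E e^(2 L(h)) E e^(-2 L(h)) = 1] for every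
    [h >= 0] ([increment_constant], which rests on [square_increment_scaling] and
    [square_scaling]). This is the equality case of the Cauchy-Schwarz inequality
    ([expR_reciprocal_moments]): [L(h)] is almost surely constant.

    The exponent is then a deterministic additive function of [ln t]
    ([levy_drift]), and the stationarity of [Y] turns a dilation of time into a
    multiplication of [X] by a constant ([self_similar_drift]). *)

(** * Laws of finite-dimensional vectors of a process *)

Lemma measurable_map_tuple d (T : measurableType d) (R : realType) (I : Type)
    (X : I -> T -> R) n (t : n.-tuple I) :
  (forall i, measurable_fun setT (X i)) ->
  measurable_fun setT (fun w => map_tuple (X ^~ w) t).
Proof.
move=> mX; apply/measurable_fun_tnthP => i.
rewrite (_ : _ \o _ = X (tnth t i)); first exact: mX.
by apply/funext => w /=; rewrite tnth_map.
Qed.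

Section process_vectors.
Context d (T : measurableType d) (R : realType) (P : probability T R).

Lemma eq_fdd_integral d' (T' : measurableType d') (Q : probability T' R)
    (I : Type) (D : set I) (X : I -> T -> R) (Z : I -> T' -> R)
    (mX : forall i, measurable_fun setT (X i))
    (mZ : forall i, measurable_fun setT (Z i))
    n (t : n.-tuple I) (F : n.-tuple R -> \bar R) :
  eq_fdd P Q D X Z -> (forall i, D (tnth t i)) ->
  measurable_fun [set: n.-tuple R] F -> (forall y, (0 <= F y)%E) ->
  (\int[P]_w F (map_tuple (X ^~ w) t) = \int[Q]_w F (map_tuple (Z ^~ w) t))%E.
Proof.
move=> XZ Dt mF F0.
pose VX : {mfun T >-> n.-tuple R} :=
  HB.pack (fun w => map_tuple (X ^~ w) t)
    (isMeasurableFun.Build _ _ _ _ _ (measurable_map_tuple t mX)).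
pose VZ : {mfun T' >-> n.-tuple R} :=
  HB.pack (fun w => map_tuple (Z ^~ w) t)
    (isMeasurableFun.Build _ _ _ _ _ (measurable_map_tuple t mZ)).
transitivity (\int[distribution P VX]_y F y)%E.
  by rewrite ge0_integral_distribution.
transitivity (\int[distribution Q VZ]_y F y)%E; last first.
  by rewrite ge0_integral_distribution.
by apply: eq_measure_integral => B mB _; exact: XZ.
Qed.

(** Independence of two processes is a statement about the sigma-algebras that
    they generate; this brings every finite-dimensional event within its reach.
    The good sets [B] form a sigma-algebra which contains the coordinate
    cylinders. *)
Lemma sigma_process_map_tuple (D : set R) (X : R -> T -> R) n
    (t : n.-tuple R) (B : set (n.-tuple R)) :
  (forall i, D (tnth t i)) -> measurable B ->
  sigma_process D X [set w | B (map_tuple (X ^~ w) t)].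
Proof.
move=> Dt mB.
pose S := image_set_system setT (fun w => map_tuple (X ^~ w) t)
  (sigma_process D X).
have -> : [set w | B (map_tuple (X ^~ w) t)] =
    setT `&` (fun w => map_tuple (X ^~ w) t) @^-1` B by rewrite setTI.
suff : S B by [].
apply: (smallest_sub _ _ mB).
  exact/sigma_algebra_image/smallest_sigma_algebra.
move=> A; rewrite -bigcup_seq => -[i _ [C mC <-]].
rewrite /S /image_set_system /= !setTI.
apply: sub_sigma_algebra; exists (tnth t i); first exact: Dt.
exists C => //; rewrite setTI.
by apply/seteqP; split => w /=; rewrite tnth_map.
Qed.

End process_vectors.

Lemma measure_preimage_ae d (T : measurableType d) (R : realType)
    (P : probability T R) n (V W : T -> n.-tuple R) (B : set (n.-tuple R)) :
  measurable_fun setT V -> measurable_fun setT W ->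
  {ae P, forall w, V w = W w} -> measurable B ->
  P (V @^-1` B) = P (W @^-1` B).
Proof.
move=> mV mW VW mB.
have int f : measurable_fun setT f ->
    P (f @^-1` B) = (\int[P]_w (\1_(f @^-1` B) w)%:E)%E.
  move=> mf; rewrite integral_indic ?setIT//.
  by rewrite -[X in measurable X]setTI; exact: mf.
rewrite !int//; apply: ge0_ae_eq_integral => //.
- apply/measurable_EFinP; apply: measurable_indic.
  by rewrite -[X in measurable X]setTI; exact: mV.
- apply/measurable_EFinP; apply: measurable_indic.
  by rewrite -[X in measurable X]setTI; exact: mW.
- apply: filterS VW => w VWw _; rewrite !indicE.
  suff -> : (w \in V @^-1` B) = (w \in W @^-1` B) by [].
  by apply/idP/idP; rewrite !inE /preimage /= VWw.
Qed.

(** * Independent random variables *)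

Definition independent_rvs d d1 d2 (T : measurableType d)
    (S1 : measurableType d1) (S2 : measurableType d2) (R : realType)
    (P : probability T R) (U : T -> S1) (V : T -> S2) :=
  forall A B, measurable A -> measurable B ->
    P (U @^-1` A `&` V @^-1` B) = (P (U @^-1` A) * P (V @^-1` B))%E.

Section independence.
Context d d1 d2 (T : measurableType d) (S1 : measurableType d1)
  (S2 : measurableType d2) (R : realType) (P : probability T R).

(** The joint law of independent variables agrees with the product of their laws
    on rectangles, hence everywhere, so this is Tonelli's theorem; both integrals
    are pulled back to the same probability space. *)
Lemma independent_integral (U : T -> S1) (V : T -> S2)
    (F : S1 * S2 -> \bar R) :
  measurable_fun setT U -> measurable_fun setT V ->
  independent_rvs P U V ->
  measurable_fun setT F -> (forall z, (0 <= F z)%E) ->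
  (\int[P]_w F (U w, V w) = \int[P]_w \int[P]_w' F (U w, V w'))%E.
Proof.
move=> mU mV UV mF F0.
pose U' : {mfun T >-> S1} := HB.pack U (isMeasurableFun.Build _ _ _ _ _ mU).
pose V' : {mfun T >-> S2} := HB.pack V (isMeasurableFun.Build _ _ _ _ _ mV).
have mUV : measurable_fun setT (fun w => (U w, V w)).
  exact: measurable_fun_pair.
pose W : {mfun T >-> (S1 * S2)%type} :=
  HB.pack (fun w => (U w, V w)) (isMeasurableFun.Build _ _ _ _ _ mUV).
transitivity (\int[distribution P W]_z F z)%E.
  by rewrite ge0_integral_distribution.
transitivity (\int[distribution P U' \x distribution P V']_z F z)%E.
  apply: eq_measure_integral => B mB _; apply/esym.
  by apply: product_measure_unique => // A C mA mC; exact: UV.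
rewrite fubini_tonelli1// ge0_integral_distribution//; last 2 first.
- exact: measurable_fun_fubini_tonelli_F.
- by move=> x; apply: integral_ge0.
apply: eq_integral => w _ /=; rewrite /fubini_F ge0_integral_distribution//.
exact: measurableT_comp.
Qed.

End independence.

Lemma independent_integralM d d1 d2 (T : measurableType d)
    (S1 : measurableType d1) (S2 : measurableType d2) (R : realType)
    (P : probability T R) (U : T -> S1) (V : T -> S2)
    (f : S1 -> R) (g : S2 -> \bar R) :
  measurable_fun setT U -> measurable_fun setT V ->
  independent_rvs P U V ->
  measurable_fun setT f -> (forall x, 0 <= f x) ->
  measurable_fun setT g -> (forall y, (0 <= g y)%E) ->
  (\int[P]_w ((f (U w))%:E * g (V w)) =
   \int[P]_w (f (U w))%:E * \int[P]_w g (V w))%E.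
Proof.
move=> mU mV UV mf f0 mg g0.
rewrite (independent_integral (F := fun z => ((f z.1)%:E * g z.2)%E))//;
  last 2 first.
- apply: emeasurable_funM.
    by apply/measurable_EFinP; exact: measurableT_comp.
  exact: measurableT_comp.
- by move=> z; rewrite mule_ge0// lee_fin.
transitivity (\int[P]_w ((f (U w))%:E * \int[P]_w' g (V w')))%E.
  apply: eq_integral => w _ /=; rewrite ge0_integralZl_EFin//.
  exact: measurableT_comp.
rewrite ge0_integralZr//.
- by apply/measurable_EFinP; exact: measurableT_comp.
- by move=> w _; rewrite lee_fin.
- exact: integral_ge0.
Qed.

(** * The equality case of the Cauchy-Schwarz inequality *)

(** Let [m] be the mean of [e^U], so that [1/m] is that of [e^(-U)]. The
    nonnegative function [e^U / m + m e^(-U) - 2] has integral [1 + 1 - 2 = 0],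
    hence vanishes almost everywhere, which forces [e^U = m]. *)
Lemma expR_reciprocal_moments d (T : measurableType d) (R : realType)
    (P : probability T R) (U : T -> R) :
  measurable_fun setT U ->
  (\int[P]_w (expR (U w))%:E * \int[P]_w (expR (- U w))%:E = 1)%E ->
  exists c, {ae P, forall w, U w = c}.
Proof.
move=> mU.
have mE : measurable_fun setT (fun w => expR (U w)).
  exact: measurableT_comp.
have mE' : measurable_fun setT (fun w => expR (- U w)).
  by apply: measurableT_comp => //; exact: measurableT_comp.
have : (0 <= \int[P]_w (expR (U w))%:E)%E.
  by apply: integral_ge0 => w _; rewrite lee_fin expR_ge0.
have : (0 <= \int[P]_w (expR (- U w))%:E)%E.
  by apply: integral_ge0 => w _; rewrite lee_fin expR_ge0.
case Em' : (\int[P]_w (expR (- U w))%:E)%E => [m'| |] //;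
  case Em : (\int[P]_w (expR (U w))%:E)%E => [m| |] // m'0 m0.
- move=> [mm'].
  have {}m0 : 0 < m.
    rewrite lt_neqAle eq_sym; apply/andP; split; last by rewrite -lee_fin.
    by apply/eqP => m_0; move: mm'; rewrite m_0 mul0r => /esym/eqP; rewrite oner_eq0.
  have m'E : m' = m^-1.
    by rewrite -[m']mul1r -(mulVf (lt0r_neq0 m0)) -mulrA mm' mulr1.
  (* [q] is [e^U / m + m e^(-U) - 2] written as a visibly nonnegative product *)
  pose q w := m * expR (- U w) * (expR (U w) / m - 1) ^+ 2.
  have q0 w : 0 <= q w.
    by rewrite mulr_ge0 ?sqr_ge0// mulr_ge0 ?expR_ge0// ltW.
  have mq : measurable_fun setT q.
    apply: measurable_funM; first exact: measurable_funM.
    by apply: measurable_funX; apply: measurable_funB => //; exact: measurable_funM.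
  have qE w : m^-1 * expR (U w) + m * expR (- U w) = q w + 2.
    rewrite /q expRN.
    have e0 : expR (U w) != 0 by rewrite gt_eqF// expR_gt0.
    by field; rewrite e0 gt_eqF.
  have sum2 : (\int[P]_w ((m^-1)%:E * (expR (U w))%:E +
                          m%:E * (expR (- U w))%:E) = 2%:E)%E.
    rewrite ge0_integralD//=.
    + rewrite !ge0_integralZl_EFin//=.
      * by rewrite Em Em' m'E -!EFinM -EFinD mulVf ?divff ?gt_eqF.
      * exact/measurable_EFinP.
      * exact: ltW.
      * exact/measurable_EFinP.
      * by rewrite invr_ge0 ltW.
    + by move=> w _; rewrite mule_ge0// lee_fin ?expR_ge0 ?invr_ge0 ?ltW.
    + by apply: emeasurable_funM => //; exact/measurable_EFinP.
    + by move=> w _; rewrite mule_ge0// lee_fin ?expR_ge0 ?ltW.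
    + by apply: emeasurable_funM => //; exact/measurable_EFinP.
  have intq2 : (\int[P]_w ((q w)%:E + 2%:E) = 2%:E)%E.
    by rewrite -[RHS]sum2; apply: eq_integral => w _; rewrite -!EFinM -!EFinD qE.
  have intq : (\int[P]_w `|(q w)%:E| = 0)%E.
    move: intq2; rewrite ge0_integralD//=; last first.
    + exact/measurable_EFinP.
    + by move=> w _; rewrite lee_fin.
    have -> : (\int[P]_w 2%:E = 2%:E)%E.
      by have := expectation_cst P 2; rewrite unlock.
    move=> /(congr1 (fun x => x - 2%:E)%E); rewrite addeK// subee// => <-.
    by apply: eq_integral => w _; rewrite /= ger0_norm.
  have mq' : measurable_fun setT (fun w => (q w)%:E) by exact/measurable_EFinP.
  have /(ae_eq_integral_abs P measurableT mq') qae := intq.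
  exists (ln m).
  apply: filterS qae => w /(_ I) [] /eqP.
  rewrite /q mulf_eq0 gt_eqF ?mulr_gt0 ?expR_gt0//= sqrf_eq0 subr_eq0.
  move=> /eqP /(congr1 ( *%R^~ m)); rewrite divfK ?gt_eqF// mul1r => <-.
  by rewrite expRK.
- move: m'0; rewrite lee_fin le_eqVlt => /predU1P[<-|m'0].
    by rewrite mule0 => /esym/eqP; rewrite onee_eq0.
  by rewrite gt0_mulye// lte_fin.
- move: m0; rewrite lee_fin le_eqVlt => /predU1P[<-|m0].
    by rewrite mul0e => /esym/eqP; rewrite onee_eq0.
  by rewrite gt0_muley// lte_fin.
Qed.

(** * Independent and stationary increments in terms of integrals *)

Section levy.
Context d (T : measurableType d) (R : realType) (P : probability T R).

Lemma measurable_increment (L : R -> {RV P >-> R}) s t :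
  measurable_fun setT (fun w => L t w - L s w).
Proof. exact: measurable_funB. Qed.

Lemma independent_increments2 (L : R -> {RV P >-> R}) (s t : R) :
  independent_increments P L -> 0 <= s -> s <= t ->
  independent_rvs P (fun w => L t w - L s w) (fun w => L s w - L 0 w).
Proof.
move=> iL s0 st A B mA mB.
(* the partition 0 <= s <= t, continued by t so as to be monotone on nat *)
pose u (k : nat) : R := if k is k'.+1 then (if k' is _.+1 then t else s) else 0.
have uh : {homo u : i j / (i <= j)%N >-> i <= j}.
  by move=> [|[|i]] [|[|j]] //= _; exact: le_trans st.
pose C (i : 'I_2) := if i == ord0 then B else A.
have mC i : measurable (C i) by rewrite /C; case: ifP.
have := iL 2%N u (lexx _) uh C mC.
rewrite big_ord_recl big_ord1 /= muleC => <-; congr (P _).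
apply/seteqP; split => w /=.
  by move=> [Aw Bw] i; rewrite /C; case: i => [[|[|i]]].
move=> Cw; split; first exact: (Cw (lift ord0 ord0)).
exact: (Cw ord0).
Qed.

Lemma stationary_increments_integral (L : R -> {RV P >-> R}) (h s t : R)
    (f : R -> \bar R) :
  stationary_increments P L -> 0 <= h -> 0 <= s -> 0 <= t ->
  measurable_fun setT f -> (forall x, (0 <= f x)%E) ->
  (\int[P]_w f (L (t + h)%R w - L (s + h)%R w)%R =
   \int[P]_w f (L t w - L s w)%R)%E.
Proof.
move=> sL h0 s0 t0 mf f0.
pose F (y : 1.-tuple R) := f (tnth y ord0).
have mF : measurable_fun [set: 1.-tuple R] F.
  by apply: measurableT_comp => //; exact: measurable_tnth.
have := @eq_fdd_integral _ _ _ P _ _ P _ _ _ _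
  (fun st => measurable_increment L (st.1 + h) (st.2 + h))
  (fun st => measurable_increment L st.1 st.2) _ [tuple (s, t)] F (sL h h0).
by apply => // [i|y]; [rewrite (ord1 i)|exact: f0].
Qed.

Lemma constant_increment_shift (L : R -> {RV P >-> R}) (h s c : R) :
  stationary_increments P L -> 0 <= h -> 0 <= s ->
  {ae P, forall w, L h w - L 0 w = c} ->
  {ae P, forall w, L (h + s) w - L s w = c}.
Proof.
move=> sL h0 s0 hc.
pose B : set (1.-tuple R) := (fun y => tnth y ord0) @^-1` (~` [set c]).
have mB : measurable B.
  rewrite -[B]setTI; apply: measurable_tnth => //.
  by apply: measurableC; exact: measurable_set1.
have mS u v : measurable (~` [set w | L v w - L u w = c]).
  rewrite -[~` _]setTI.
  apply: (measurable_increment L u v measurableT (Y := ~` [set c])).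
  by apply: measurableC; exact: measurable_set1.
apply/negligibleP; first exact: mS.
move/(negligibleP _ (mS _ _)) : hc => <-.
have D i : [set st : R * R | 0 <= st.1 /\ 0 <= st.2] (tnth [tuple (0, h)] i).
  by rewrite (ord1 i).
have := sL s s0 1%N [tuple (0, h)] D B mB.
by rewrite /B /= /tnth /= add0r.
Qed.

End levy.
(** * Second moments of the exponential-stationary product *)

Section levy_and_stationary.
Context d (T : measurableType d) (R : realType) (P : probability T R).

Lemma independent_processes_tuples (L Y : R -> {RV P >-> R}) (D E : set R)
    n m (s : n.-tuple R) (t : m.-tuple R) :
  independent_processes P D L E Y ->
  (forall i, D (tnth s i)) -> (forall i, E (tnth t i)) ->
  independent_rvs P (fun w => map_tuple (fun r => L r w) s)
    (fun w => map_tuple (fun r => Y r w) t).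
Proof.
move=> LY Ds Et A B mA mB.
by apply: LY; [exact: (sigma_process_map_tuple (X := L) Ds mA)
  |exact: (sigma_process_map_tuple (X := Y) Et mB)].
Qed.

(** Once the integral over [Y] is separated from the one over [L], the
    stationarity of [Y] removes the time shift [h] from the inner integral. *)
Lemma independent_stationary_integral (L Y : R -> {RV P >-> R})
    n m (s : n.-tuple R) (t : m.-tuple R) (h : R)
    (F : n.-tuple R * m.-tuple R -> \bar R) :
  independent_processes P [set s | 0 <= s] L setT Y -> stationary P Y ->
  (forall i, 0 <= tnth s i) ->
  measurable_fun setT F -> (forall z, (0 <= F z)%E) ->
  (\int[P]_w F (map_tuple (fun r => L r w) s,
                map_tuple (fun r => Y (r + h)%R w) t) =
   \int[P]_w \int[P]_w' F (map_tuple (fun r => L r w) s,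
                           map_tuple (fun r => Y r w') t))%E.
Proof.
move=> LY sY s0 mF F0.
have mL : measurable_fun setT (fun w => map_tuple (fun r => L r w) s).
  exact: (measurable_map_tuple (X := L)).
have mY : measurable_fun setT (fun w => map_tuple (fun r => Y (r + h) w) t).
  exact: (measurable_map_tuple (X := fun r => Y (r + h))).
have indep : independent_rvs P (fun w => map_tuple (fun r => L r w) s)
    (fun w => map_tuple (fun r => Y (r + h) w) t).
  have := independent_processes_tuples (t := map_tuple (+%R^~ h) t) LY s0 (fun=> I).
  congr independent_rvs; apply/funext => w.
  by apply/val_inj; rewrite /= -map_comp.
rewrite (independent_integral mL mY indep mF F0).
apply: eq_integral => w _.
pose G y := F (map_tuple (fun r => L r w) s, y).
have mG : measurable_fun setT G by exact: measurableT_comp.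
by apply: (@eq_fdd_integral _ _ _ P _ _ P _ _ (fun r => Y (r + h)) Y _ _ _ t G
  (sY h)) => // y; exact: F0.
Qed.

(** In the representation with parameter [h + s], [S h] is the second moment of
    [X(e^(h+s)) - X(e^h)]. Both terms carry the factor [e^(L(s) - L(h+s))]; what
    is left depends on [L] only through [L(s) - L(0)], which is independent of
    that factor, and on the pair [Y(h), Y(h+s)], whose law does not depend on
    [h]. *)
Lemma square_increment_scaling (L Y : R -> {RV P >-> R}) (h s : R) :
  independent_increments P L -> stationary P Y ->
  independent_processes P [set s | 0 <= s] L setT Y ->
  0 <= h -> 0 <= s ->
  let S h := (\int[P]_w ((expR (L 0 w - L (h + s) w) * Y (h + s) w
    - expR (L s w - L (h + s) w) * Y h w) ^+ 2)%:E)%E in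
  (S h = \int[P]_w (expR (- (2 * (L (h + s)%R w - L s w)))%R)%:E * S 0%R)%E.
Proof.
move=> iL sY LY h0 s0 S.
(* the inner second moment given [L s - L 0 = v], after shifting [Y] to time 0 *)
pose H (v : R) := (\int[P]_w ((expR (- v) * Y s w - Y 0 w) ^+ 2)%:E)%E.
have H0 v : (0 <= H v)%E.
  by apply: integral_ge0 => w _; rewrite lee_fin sqr_ge0.
have mH : measurable_fun setT H.
  pose f (z : R * T) := ((expR (- z.1) * Y s z.2 - Y 0 z.2) ^+ 2)%:E.
  apply: (@measurable_fun_fubini_tonelli_F _ _ _ _ _ P f).
    apply/measurable_EFinP; apply: measurable_funX; apply: measurable_funB.
      apply: measurable_funM; last exact: measurableT_comp.
      by apply: measurableT_comp => //; exact: measurableT_comp.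
    exact: measurableT_comp.
  by move=> z; rewrite lee_fin sqr_ge0.
have SE (k : R) : 0 <= k -> (S k =
    \int[P]_w ((expR (- (2 * (L (k + s)%R w - L s w)))%R)%:E *
               H (L s w - L 0 w)%R))%E.
  move=> k0.
  pose F (z : 3.-tuple R * 2.-tuple R) :=
    ((expR (tnth z.1 ord0 - tnth z.1 (@Ordinal 3 2 isT)) *
        tnth z.2 (@Ordinal 2 1 isT)
      - expR (tnth z.1 (@Ordinal 3 1 isT) - tnth z.1 (@Ordinal 3 2 isT)) *
        tnth z.2 ord0) ^+ 2)%:E.
  have m1 i : measurable_fun setT (fun z : 3.-tuple R * 2.-tuple R => tnth z.1 i).
    exact: (measurableT_comp (measurable_tnth i) measurable_fst).
  have m2 i : measurable_fun setT (fun z : 3.-tuple R * 2.-tuple R => tnth z.2 i).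
    exact: (measurableT_comp (measurable_tnth i) measurable_snd).
  have mF : measurable_fun setT F.
    apply/measurable_EFinP; apply: measurable_funX; apply: measurable_funB.
      apply: measurable_funM => //; apply: measurableT_comp => //.
      exact: measurable_funB.
    apply: measurable_funM => //; apply: measurableT_comp => //.
    exact: measurable_funB.
  have F0 z : (0 <= F z)%E by rewrite lee_fin sqr_ge0.
  have s3 i : 0 <= tnth [tuple 0; s; k + s] i.
    by case: i => [[|[|[|i]]]] // ?; rewrite /tnth //= addr_ge0.
  transitivity (\int[P]_w F (map_tuple (fun r => L r w) [tuple 0; s; k + s]%R,
                  map_tuple (fun r => Y (r + k)%R w) [tuple 0; s]%R))%E.
    by apply: eq_integral => w _; rewrite /F /tnth /= add0r (addrC s k).
  rewrite (independent_stationary_integral _ _ LY sY s3 mF F0).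
  apply: eq_integral => w _; rewrite /H -ge0_integralZl_EFin//=.
  - apply: eq_integral => w' _; rewrite /F /tnth /= -EFinM; congr (_%:E).
    have -> : - (2 * (L (k + s) w - L s w)) =
      (L s w - L (k + s) w) + (L s w - L (k + s) w) by ring.
    have -> : L 0 w - L (k + s) w =
      - (L s w - L 0 w) + (L s w - L (k + s) w) by ring.
    rewrite !expRD; ring.
  - by move=> w' _; rewrite lee_fin sqr_ge0.
  - apply/measurable_EFinP; apply: measurable_funX; apply: measurable_funB => //.
    exact: measurable_funM.
have S0 : (S 0%R = \int[P]_w H (L s w - L 0 w)%R)%E.
  rewrite SE//; apply: eq_integral => w _.
  by rewrite add0r subrr mulr0 oppr0 expR0 mul1e.
rewrite SE// S0.
pose f x : R := expR (- (2 * x)).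
apply: (independent_integralM (f := f) (g := H)
  (U := fun w => L (h + s) w - L s w) (V := fun w => L s w - L 0 w)) => //.
- exact: measurable_increment.
- exact: measurable_increment.
- by apply: independent_increments2 => //; rewrite lerDr.
- exact: (measurableT_comp (@measurable_expR R)
    (measurableT_comp (@oppr_measurable R setT) (mulrl_measurable 2))).
- by move=> x; exact: expR_ge0.
Qed.

(** In the representation with parameter [0], the left-hand side is the second
    moment of [X(e^(-h))]. *)
Lemma square_scaling (L Y : R -> {RV P >-> R}) (h : R) :
  stationary P Y ->
  independent_processes P [set s | 0 <= s] L setT Y -> 0 <= h ->
  (\int[P]_w ((expR (L h w - L 0 w) * Y (- h) w) ^+ 2)%:E =
   \int[P]_w (expR (2 * (L h w - L 0 w))%R)%:E *
   \int[P]_w ((Y 0 w ^+ 2)%:E))%E.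
Proof.
move=> sY LY h0.
pose F (z : 2.-tuple R * 1.-tuple R) :=
  ((expR (tnth z.1 (@Ordinal 2 1 isT) - tnth z.1 ord0) * tnth z.2 ord0) ^+ 2)%:E.
have m1 i : measurable_fun setT (fun z : 2.-tuple R * 1.-tuple R => tnth z.1 i).
  exact: (measurableT_comp (measurable_tnth i) measurable_fst).
have m2 i : measurable_fun setT (fun z : 2.-tuple R * 1.-tuple R => tnth z.2 i).
  exact: (measurableT_comp (measurable_tnth i) measurable_snd).
have mF : measurable_fun setT F.
  apply/measurable_EFinP; apply: measurable_funX.
  apply: measurable_funM => //; apply: measurableT_comp => //.
  exact: measurable_funB.
have F0 z : (0 <= F z)%E by rewrite lee_fin sqr_ge0.
have s2 i : 0 <= tnth [tuple 0; h] i by case: i => [[|[|i]]].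
transitivity (\int[P]_w F (map_tuple (fun r => L r w) [tuple 0; h]%R,
                map_tuple (fun r => Y (r - h)%R w) [tuple 0]%R))%E.
  by apply: eq_integral => w _; rewrite /F /tnth /= add0r.
rewrite (independent_stationary_integral _ _ LY sY s2 mF F0).
have mY : measurable_fun setT (fun w => (Y 0 w ^+ 2)%:E).
  by apply/measurable_EFinP; exact: measurable_funX.
rewrite -ge0_integralZr//; last 2 first.
- apply/measurable_EFinP; apply: measurableT_comp => //.
  apply: measurable_funM => //; exact: measurable_increment.
- by apply: integral_ge0 => w _; rewrite lee_fin sqr_ge0.
apply: eq_integral => w _; rewrite -ge0_integralZl_EFin//.
- apply: eq_integral => w' _; rewrite /F /tnth /= -EFinM exprMn.
  by rewrite -expRM_natl mulr_natl.
- by move=> w' _; rewrite lee_fin sqr_ge0.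
Qed.

End levy_and_stationary.
(** * The increments of L are deterministic *)

Lemma square_increment_null_at_0 d (T : measurableType d) (R : realType)
    (Q : probability T R) (X : R -> {RV Q >-> R}) (s t : R) :
  stationary_increments Q (null_at_0 X) -> 0 < s -> 0 < t ->
  (\int[Q]_w ((X (s + t) w - X s w) ^+ 2)%:E = \int[Q]_w (X t w ^+ 2)%:E)%E.
Proof.
move=> sX s0 t0.
have mX u : measurable_fun setT (null_at_0 X u).
  by rewrite /null_at_0; case: eqP.
pose F (y : 1.-tuple R) := (tnth y ord0 ^+ 2)%:E.
have mF : measurable_fun [set: 1.-tuple R] F.
  by apply/measurable_EFinP; apply: measurable_funX; exact: measurable_tnth.
have D i : [set u : R * R | 0 <= u.1 /\ 0 <= u.2] (tnth [tuple (0, t)] i).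
  by rewrite (ord1 i); split => //; exact: ltW.
have F0 y : (0 <= F y)%E by rewrite lee_fin sqr_ge0.
have := @eq_fdd_integral _ _ _ Q _ _ Q _ _ _ _
  (fun u => measurable_funB (mX (u.2 + s)) (mX (u.1 + s)))
  (fun u => measurable_funB (mX u.2) (mX u.1)) _ _ F (sX s (ltW s0)) D mF F0.
congr eq; apply: eq_integral => w _; rewrite /F /tnth /= /null_at_0.
  by rewrite add0r !gt_eqF ?addr_gt0// (addrC t s).
by rewrite eqxx gt_eqF// subr0.
Qed.

Section representation.
Context (R : realType) (d d' : measure_display) (T : measurableType d)
  (T' : measurableType d') (P : probability T R) (Q : probability T' R).

(** Logarithmic times: the times [e^u] with [u <= a] are those at which the
    representation with parameter [a] is available. *)
Lemma representation_integral (L Y : R -> {RV P >-> R}) (X : R -> {RV Q >-> R})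
    (a : R) n (t : n.-tuple R) (F : n.-tuple R -> \bar R) :
  eq_fdd Q P [set t | 0 < t <= expR a] X
    (fun t w => expR (L (a - ln t) w - L a w) * Y (ln t) w) ->
  (forall i, tnth t i <= a) ->
  measurable_fun setT F -> (forall y, (0 <= F y)%E) ->
  (\int[Q]_w F (map_tuple (fun u => X (expR u) w) t) =
   \int[P]_w F (map_tuple (fun u => expR (L (a - u)%R w - L a w) * Y u w)%R t))%E.
Proof.
move=> XLY ta mF F0.
have mLY u : measurable_fun setT
    (fun w => expR (L (a - ln u) w - L a w) * Y (ln u) w).
  apply: measurable_funM => //; apply: measurableT_comp => //.
  exact: measurable_funB.
have D i : [set t | 0 < t <= expR a] (tnth (map_tuple (@expR R) t) i).
  by rewrite tnth_map /= expR_gt0 ler_expR ta.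
have := @eq_fdd_integral _ _ _ Q _ _ P _ _ X _ (fun=> measurable_funPT _)
  mLY n _ F XLY D mF F0.
congr eq; apply: eq_integral => w _; congr F; apply/val_inj;
  rewrite /= -map_comp //.
by apply: eq_map => u /=; rewrite expRK.
Qed.

Lemma representation_square (L Y : R -> {RV P >-> R}) (X : R -> {RV Q >-> R})
    (a u : R) :
  eq_fdd Q P [set t | 0 < t <= expR a] X
    (fun t w => expR (L (a - ln t) w - L a w) * Y (ln t) w) -> u <= a ->
  (\int[Q]_w (X (expR u) w ^+ 2)%:E =
   \int[P]_w ((expR (L (a - u) w - L a w) * Y u w) ^+ 2)%:E)%E.
Proof.
move=> XLY ua.
pose F (y : 1.-tuple R) := (tnth y ord0 ^+ 2)%:E.
have := @representation_integral L Y X a _ [tuple u] F XLY.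
rewrite /F /tnth /=; apply.
- by move=> i; rewrite (ord1 i).
- by apply/measurable_EFinP; apply: measurable_funX; exact: measurable_tnth.
- by move=> y; rewrite lee_fin sqr_ge0.
Qed.

Lemma representation_square_increment (L Y : R -> {RV P >-> R})
    (X : R -> {RV Q >-> R}) (a u v : R) :
  eq_fdd Q P [set t | 0 < t <= expR a] X
    (fun t w => expR (L (a - ln t) w - L a w) * Y (ln t) w) ->
  u <= a -> v <= a ->
  (\int[Q]_w ((X (expR v) w - X (expR u) w) ^+ 2)%:E =
   \int[P]_w ((expR (L (a - v) w - L a w) * Y v w
             - expR (L (a - u) w - L a w) * Y u w) ^+ 2)%:E)%E.
Proof.
move=> XLY ua va.
pose F (y : 2.-tuple R) := ((tnth y (@Ordinal 2 1 isT) - tnth y ord0) ^+ 2)%:E.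
have := @representation_integral L Y X a _ [tuple u; v] F XLY.
rewrite /F /tnth /=; apply.
- by move=> [[|[|i]]].
- apply/measurable_EFinP; apply: measurable_funX.
  by apply: measurable_funB; exact: measurable_tnth.
- by move=> y; rewrite lee_fin sqr_ge0.
Qed.

Lemma stationary_square_gt0 (Y : R -> {RV P >-> R}) :
  stationary P Y -> not_identically_null P setT Y ->
  (0 < \int[P]_w (Y 0 w ^+ 2)%:E)%E.
Proof.
move=> sY [t [_ _ Yt]].
rewrite lt0e integral_ge0 ?andbT; last by move=> w _; rewrite lee_fin sqr_ge0.
apply/eqP => Y0.
have mY : measurable_fun setT (fun w => (Y 0 w ^+ 2)%:E).
  by apply/measurable_EFinP; exact: measurable_funX.
have /(ae_eq_integral_abs P measurableT mY) Yae :
    (\int[P]_w `|(Y 0 w ^+ 2)%:E| = 0)%E.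
  by rewrite -Y0; apply: eq_integral => w _; rewrite /= ger0_norm// sqr_ge0.
pose B : set (1.-tuple R) := (fun y => tnth y ord0) @^-1` (~` [set 0]).
have mB : measurable B.
  rewrite -[B]setTI; apply: measurable_tnth => //.
  by apply: measurableC; exact: measurable_set1.
have mN : measurable (Y 0 @^-1` (~` [set 0])).
  by rewrite -[X in measurable X]setTI; apply: measurable_funP => //;
    apply: measurableC; exact: measurable_set1.
have := sY t 1%N [tuple 0] (fun=> I) B mB.
rewrite /B /tnth /= add0r => E.
have N0 : P (Y 0 @^-1` (~` [set 0])) = 0%E.
  apply: measure_negligible => //; apply: negligibleS Yae.
  by move=> w /= Y0w /(_ I) [] /eqP; rewrite sqrf_eq0 => /eqP.
have : P [set w | Y t w != 0] = 0%E.
  rewrite -N0 -[in RHS]E; congr (P _).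
  by apply/seteqP; split => w /= /eqP.
by move=> Y0t; rewrite Y0t ltxx in Yt.
Qed.

(** With [l = e^h], [s = ln (1 + 1/l)] and [m2 = E Y(0)^2 = E X(1)^2], the increment
    [X(l + 1) - X(l)] is at once distributed as [X(1)] and, by scaling, of second
    moment [B E (X(1 + 1/l) - X(1))^2 = B E X(1/l)^2 = B A m2], where [A] and [B]
    are the means of [e^(2 (L h - L 0))] and of its inverse. Since [0 < m2 < oo],
    [A B = 1]. *)
Lemma increment_constant (L Y : R -> {RV P >-> R}) (X : R -> {RV Q >-> R})
    (h : R) :
  not_identically_null P setT Y -> levy_process P L -> stationary P Y ->
  independent_processes P [set s | 0 <= s] L setT Y ->
  (forall a : R, 0 <= a ->
     eq_fdd Q P [set t | 0 < t <= expR a] X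
       (fun t w => expR (L (a - ln t) w - L a w) * Y (ln t) w)) ->
  finite_variance Q X -> stationary_increments Q (null_at_0 X) ->
  0 <= h -> exists c, {ae P, forall w, L h w - L 0 w = c}.
Proof.
move=> Y_nonnull [_ sL iL _] sY LY XLY fX sX h0.
pose m2 := (\int[P]_w (Y 0 w ^+ 2)%:E)%E.
pose A := (\int[P]_w (expR (2 * (L h w - L 0 w))%R)%:E)%E.
pose B := (\int[P]_w (expR (- (2 * (L h w - L 0 w)))%R)%:E)%E.
pose s := ln (1 + expR (- h)).
have s0 : 0 <= s by rewrite ln_ge0// lerDl expR_ge0.
have Es : expR s = 1 + expR (- h) by rewrite lnK// posrE addr_gt0// expR_gt0.
have X1 : (\int[Q]_w (X 1 w ^+ 2)%:E = m2)%E.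
  have := representation_square (XLY 0 (lexx _)) (lexx 0).
  rewrite expR0 => ->; apply: eq_integral => w _.
  by rewrite subrr subrr expR0 mul1r.
have increment k : 0 <= k ->
    (\int[Q]_w ((X (expR (k + s)) w - X (expR k) w) ^+ 2)%:E =
    \int[P]_w ((expR (L 0 w - L (k + s) w) * Y (k + s) w
    - expR (L s w - L (k + s) w) * Y k w) ^+ 2)%:E)%E.
  move=> k0; have ks0 : 0 <= k + s by rewrite addr_ge0.
  have kks : k <= k + s by rewrite lerDl.
  rewrite (representation_square_increment (XLY _ ks0) kks (lexx _)).
  by apply: eq_integral => w _; rewrite subrr (addrC k) addrK.
have large : (\int[Q]_w ((X (expR (h + s)) w - X (expR h) w) ^+ 2)%:E = m2)%E.
  rewrite expRD Es mulrDr mulr1 -expRD subrr expR0.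
  by rewrite square_increment_null_at_0// expR_gt0.
have small : (\int[Q]_w ((X (expR (0 + s)) w - X (expR 0) w) ^+ 2)%:E = A * m2)%E.
  rewrite add0r Es expR0 square_increment_null_at_0// ?expR_gt0//.
  rewrite (representation_square (XLY 0 (lexx _))) ?oppr_le0//.
  rewrite -(square_scaling sY LY h0); apply: eq_integral => w _.
  by rewrite sub0r opprK.
have := square_increment_scaling iL sY LY h0 s0.
rewrite /= -!increment// large small.
have -> : (\int[P]_w (expR (- (2 * (L (h + s)%R w - L s w)))%R)%:E = B)%E.
  rewrite /B -[in RHS](stationary_increments_integral
    (f := fun x => (expR (- (2 * x)))%:E) sL s0 (lexx 0) h0).
  - by rewrite add0r.
  - apply/measurable_EFinP.
    exact: (measurableT_comp (@measurable_expR R)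
      (measurableT_comp (@oppr_measurable R setT) (mulrl_measurable 2))).
  - by move=> x; rewrite lee_fin expR_ge0.
have m2_gt0 : (0 < m2)%E by exact: stationary_square_gt0.
have m2_fin : (m2 < +oo)%E by have := fX 1 ltr01; rewrite unlock X1.
have {}m2_fin : m2 \is a fin_num by rewrite ge0_fin_numE// ltW.
move=> m2E.
have AB : (A * B = 1)%E.
  (* cancel m2 from [m2 = B A m2] *)
  have mm : (m2 / m2 = 1)%E by rewrite divee// gt_eqF.
  by rewrite -[RHS]mm [in X in _ = (X / _)%E]m2E -!muleA mm mule1 muleC.
have m2L : measurable_fun setT (fun w => 2 * (L h w - L 0 w)).
  by apply: measurable_funM => //; exact: measurable_increment.
have [c cae] := expR_reciprocal_moments m2L AB.
exists (c / 2); apply: filterS cae => w <-.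
by rewrite mulrAC divff ?mul1r.
Qed.

(** The increments of [L], each almost surely constant, combine into an additive
    function [k] of the (signed) time difference; [k] is minus the drift, as time
    is reversed. Additivity is read off at any single sample point where the three
    almost sure identities involved hold. *)
Lemma levy_drift (L : R -> {RV P >-> R}) :
  stationary_increments P L ->
  (forall h, 0 <= h -> exists c, {ae P, forall w, L h w - L 0 w = c}) ->
  exists2 k : R -> R, {morph k : u v / u + v} &
    forall a u, 0 <= a -> u <= a -> {ae P, forall w, L (a - u) w - L a w = k u}.
Proof.
move=> sL cL.
have /choice [c cE] : forall h, exists c, 0 <= h ->
    {ae P, forall w, L h w - L 0 w = c}.
  move=> h; have [h0|h0] := leP 0 h; last by exists 0.
  by have [c ?] := cL _ h0; exists c.
pose k u := if 0 <= u then - c u else c (- u).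
have kE a u : 0 <= a -> u <= a -> {ae P, forall w, L (a - u) w - L a w = k u}.
  move=> a0 ua; rewrite /k; case: ifPn => [u0|]; last rewrite -ltNge => u0.
    have au : 0 <= a - u by rewrite subr_ge0.
    have := constant_increment_shift sL u0 au (cE _ u0).
    by apply: filterS => w <-; rewrite opprB (addrC u) subrK.
  have u0' : 0 <= - u by rewrite oppr_ge0 ltW.
  have := constant_increment_shift sL u0' a0 (cE _ u0').
  by apply: filterS => w <-; rewrite (addrC a).
exists k => // u v.
(* large enough for all of the times a, a - v and a - v - u to be nonnegative *)
pose a := `|u| + `|v|.
have a0 : 0 <= a by rewrite addr_ge0.
have va : v <= a by rewrite (le_trans (ler_norm v))// lerDr.
have av0 : 0 <= a - v.
  by rewrite subr_ge0.
have uav : u <= a - v.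
  by rewrite lerBrDr lerD// ler_norm.
have uva : u + v <= a by rewrite lerD// ler_norm.
have P1 : (0 < P [set: T])%E by rewrite probability_setT.
have PF := ae_properfilter_algebraOfSetsType P1.
have [w [[]]] := filter_ex
  (filterI (filterI (kE _ _ a0 uva) (kE _ _ a0 va)) (kE _ _ av0 uav)).
move=> <- <- <-; rewrite -(addrC v u) opprD addrA.
by rewrite subrKA.
Qed.

End representation.

(** * Self-similarity for a deterministic exponent *)

(** The restriction to [t <= e^a] disappears: [k] does not depend on [a], and any
    finite set of times lies below some [e^a]. *)
Lemma representation_drift (R : realType) (d d' : measure_display)
    (T : measurableType d) (T' : measurableType d') (P : probability T R)
    (Q : probability T' R) (L Y : R -> {RV P >-> R}) (X : R -> {RV Q >-> R})
    (k : R -> R) :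
  (forall a : R, 0 <= a ->
     eq_fdd Q P [set t | 0 < t <= expR a] X
       (fun t w => expR (L (a - ln t) w - L a w) * Y (ln t) w)) ->
  (forall a u, 0 <= a -> u <= a ->
     {ae P, forall w, L (a - u) w - L a w = k u}) ->
  eq_fdd Q P [set t | 0 < t] X (fun t w => expR (k (ln t)) * Y (ln t) w).
Proof.
move=> XLY kE n t t_gt0 B mB.
have t0 i : 0 < tnth t i := t_gt0 i.
(* any nonnegative common upper bound of the ln (tnth t i) would do *)
pose a := \sum_(i < n) `|ln (tnth t i)|.
have a0 : 0 <= a by exact: sumr_ge0.
have ta i : ln (tnth t i) <= a.
  rewrite (le_trans (ler_norm _))// /a (bigD1 i)//= lerDl.
  exact: sumr_ge0.
rewrite (XLY a a0 n t)//; last first.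
  move=> i /=; rewrite t0/= -[leLHS]lnK ?ler_expR ?ta//.
  by rewrite posrE t0.
have mLY u : measurable_fun setT
    (fun w => expR (L (a - ln u) w - L a w) * Y (ln u) w).
  apply: measurable_funM => //; apply: measurableT_comp => //.
  exact: measurable_funB.
have mkY u : measurable_fun setT (fun w => expR (k (ln u)) * Y (ln u) w).
  exact: measurable_funM.
apply: (measure_preimage_ae (measurable_map_tuple t mLY)
  (measurable_map_tuple t mkY)) => //.
have : {ae P, forall w, forall i,
    L (a - ln (tnth t i)) w - L a w = k (ln (tnth t i))}.
  by apply: filter_forall => i; exact: kE.
apply: filterS => w Hw; apply: eq_from_tnth => i.
by rewrite !tnth_map Hw.
Qed.

(** Dilating time by [a] shifts the argument of [Y] by [ln a], which its stationarity
    ignores, and by additivity multiplies [e^(k (ln t))] by the constant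
    [e^(k (ln a))]. *)
Lemma self_similar_drift (R : realType) (d d' : measure_display)
    (T : measurableType d) (T' : measurableType d') (P : probability T R)
    (Q : probability T' R) (Y : R -> {RV P >-> R}) (X : R -> {RV Q >-> R})
    (k : R -> R) :
  {morph k : u v / u + v} -> stationary P Y ->
  eq_fdd Q P [set t | 0 < t] X (fun t w => expR (k (ln t)) * Y (ln t) w) ->
  self_similar Q X.
Proof.
move=> kD sY XkY a a0; exists (expR (k (ln a))); first exact: expR_gt0.
move=> n t t_gt0 B mB.
have t0 i : 0 < tnth t i := t_gt0 i.
pose b := expR (k (ln a)).
(* with [scale], dilated times and rescaled values both become events about
   the single vector of the Y (ln (tnth t i)) *)
pose scale (c : R -> R) (y : n.-tuple R) : n.-tuple R :=
  [tuple c (tnth t i) * tnth y i | i < n].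
have mscale c : measurable_fun [set: n.-tuple R] (scale c).
  apply/measurable_fun_tnthP => i.
  rewrite (_ : _ \o _ = fun y => c (tnth t i) * tnth y i).
    by apply: measurable_funM => //; exact: measurable_tnth.
  by apply/funext => y /=; rewrite tnth_mktuple.
have mpre c : measurable (scale c @^-1` B).
  by rewrite -[X in measurable X]setTI; exact: mscale.
transitivity (Q [set w | B (map_tuple (X^~ w) (map_tuple ( *%R a) t))]).
  congr (Q _); apply/funext => w /=; congr B;
  by apply: eq_from_tnth => i; rewrite !tnth_map.
rewrite XkY//; last by move=> i; rewrite tnth_map /= mulr_gt0// t0.
transitivity (Q [set w | (scale (fun=> b) @^-1` B) (map_tuple (X^~ w) t)]);
  last first.
  congr (Q _); apply/funext => w /=; congr B; apply: eq_from_tnth => i.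
  by rewrite /scale !(tnth_mktuple, tnth_map).
rewrite XkY//.
pose S := scale (fun t => b * expR (k (ln t))) @^-1` B.
have YS := sY (ln a) n (map_tuple (@ln R) t) (fun=> I) S (mpre _).
transitivity (P [set w | S (map_tuple (fun u => Y (u + ln a) w)
  (map_tuple (@ln R) t))]).
  congr (P _); apply/funext => w /=; congr B;
  apply: eq_from_tnth => i; rewrite /scale !(tnth_mktuple, tnth_map);
  by rewrite lnM ?posrE ?t0// kD expRD (addrC (ln a)).
rewrite YS; congr (P _); apply/funext => w /=; congr B;
  apply: eq_from_tnth => i; rewrite /scale !(tnth_mktuple, tnth_map).
by rewrite mulrA.
Qed.

Theorem mainTheorem9 (R : realType)
    (d d' : measure_display) (T : measurableType d) (T' : measurableType d')
    (P : probability T R) (Q : probability T' R)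
    (L : R -> {RV P >-> R}) (Y : R -> {RV P >-> R}) (X : R -> {RV Q >-> R})
    (L_nonnull : not_identically_null P [set s | 0 <= s] L)
    (Y_nonnull : not_identically_null P setT Y)
    (X_nonnull : not_identically_null Q [set t | 0 < t] X)
    (L_levy : levy_process P L)
    (Y_stationary : stationary P Y)
    (L_Y_independent : independent_processes P [set s | 0 <= s] L setT Y)
    (X_def : forall a : R, 0 <= a ->
       eq_fdd Q P [set t | 0 < t <= expR a] X
         (fun t w => expR (L (a - ln t) w - L a w) * Y (ln t) w))
    (X_finite_variance : finite_variance Q X) :
  stationary_increments Q (null_at_0 X) -> self_similar Q X.
Proof.
move=> X_increments.
have [k kD kE] := levy_drift (let: And4 _ sL _ _ := L_levy in sL)
  (fun h => increment_constant Y_nonnull L_levy Y_stationary L_Y_independent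
     X_def X_finite_variance X_increments (h := h)).
exact: (self_similar_drift kD Y_stationary (representation_drift X_def kE)).
Qed.
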